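(* Let $q\geq 3$ be a prime power. Then: (1) $M_2(q^2-2)=\dfrac{q^2+q}{2}$; (2) if $q$ is even and $q\geq 8$, then for each odd integer $k$ with $3\leq k\leq q-3$, $M_2(q^2-k-1)=\dfrac{q^2+q-k+1}{2}$; (3) if $q$ is even, then $M_2((q-1)^2-2)=\dfrac{(q-1)^2+q-3}{2}+1$; (4) if $q$ is odd, then for each even integer $k$ with $2\leq k\leq 2\lceil q/4\rceil$, $M_2(q^2-k)=\dfrac{q^2+q-k}{2}+1$.
   Context: For integers $c,s\geq 1$, $K_{c\times s}$ denotes the complete multipartite graph with $c$ classes of $s$ vertices each. For a subgraph $H$ of $K_{c\times s}$, $\overline{H}$ denotes the complement of $H$ relative to $K_{c\times s}$. $C_4$ is the $4$-cycle and $K_{1,n}$ is the star with $n+1$ vertices. $M_s(n)$ is the smallest positive integer $c$ such that for every subgraph $H$ of $K_{c\times s}$, $H$ contains a copy of $C_4$ or $\overline{H}$ contains a copy of $K_{1,n}$. *)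

(* Defs.v *)
From mathcomp Require Import all_boot.

Set Implicit Arguments.
Unset Strict Implicit.
Unset Printing Implicit Defensive.

Definition prime_power (q : nat) : Prop :=
  exists p m : nat, [/\ prime p, 0 < m & q = p ^ m].

Definition ceil_divn (m d : nat) : nat := (m + d.-1) %/ d.

(* Graphs are given by their adjacency relations. [contains_copy F G] : G has a
   (not necessarily induced) subgraph isomorphic to F. *)
Definition contains_copy (V W : finType) (F : rel V) (G : rel W) : Prop :=
  exists f : V -> W, injective f /\ forall x y, F x y -> G (f x) (f y).

Definition C4 : rel 'I_4 :=
  fun i j => (j == i.+1 %% 4 :> nat) || (i == j.+1 %% 4 :> nat).

(* K_{1,n}, with centre 0 and leaves 1, ..., n. *)
Definition star (n : nat) : rel 'I_n.+1 :=
  fun i j => (i == ord0) (+) (j == ord0).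
Arguments star n : clear implicits.

(* K_{c x s}: the vertex (i, j) is the j-th vertex of the i-th class. *)
Definition Kmult (c s : nat) : rel ('I_c * 'I_s) := fun x y => x.1 != y.1.
Arguments Kmult c s : clear implicits.

(* Subgraphs are taken on the whole vertex set, so that H and its relative
   complement partition the edges of K_{c x s}. *)
Definition subgraph_Kmult (c s : nat) (H : rel ('I_c * 'I_s)) : Prop :=
  symmetric H /\ subrel H (Kmult c s).

Definition rel_compl (c s : nat) (H : rel ('I_c * 'I_s)) : rel ('I_c * 'I_s) :=
  fun x y => Kmult c s x y && ~~ H x y.

Definition arrows (s n c : nat) : Prop :=
  forall H : rel ('I_c * 'I_s), subgraph_Kmult H ->
    contains_copy C4 H \/ contains_copy (star n) (rel_compl H).

(* [is_M s n c] reads M_s(n) = c: the minimum exists and equals c. *)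
Definition is_M (s n c : nat) : Prop :=
  [/\ 0 < c, arrows s n c & forall c', 0 < c' -> arrows s n c' -> c <= c'].

(* Main.v *)
(** A [C4]-free graph on [2c] vertices with minimum degree [d] satisfies
    [d (d - 1) < 2c], since the 2-paths leaving a vertex have distinct ends
    other than that vertex; this gives the upper bounds.

    For the lower bounds in (1), (2) and (4), delete [m] points of the conic
    [(t, t^2, 1)] from the polarity graph of [PG(2, q)] attached to the form
    [e x x' - y z' - z y'], where [e = 2] for odd [q] and [e = 1] for even [q].
    Polar lines meet the conic in at most two points, and polars of absolute
    points are tangent to it (for even [q] they pass through its nucleus), so
    all degrees remain at least [q - 1].

    For (3), deleting the absolute line and its pole from the polarity graph
    leaves the graph on the nonzero vectors of [F_q^2] with [u ~ v] iff
    [det (u, v) = 1], which is [q]-regular. Deleting the [q + 1] points of a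
    conic disjoint from the absolute line, which every line meets at most twice,
    leaves degrees at least [q - 2].

    Finally, a graph of maximum degree less than half its order has a perfect
    matching in its complement, which provides the classes of [K_{c x 2}]. *)

From HB Require Import structures.
Require Import Defs.
From mathcomp Require Import all_boot all_fingroup all_algebra all_field.
From mathcomp Require Import zify ring.

Set Implicit Arguments.
Unset Strict Implicit.
Unset Printing Implicit Defensive.

(** * Counting 2-paths *)

(** Restrict [H] to the first [c] classes: they induce [K_{c x s}], and both kinds of copies carry
    over to [d] classes. *)
Lemma arrows_leq (s n c d : nat) : c <= d -> arrows s n c -> arrows s n d.
Proof.
move=> lecd arr H [symH subH].
pose f (x : 'I_c * 'I_s) : 'I_d * 'I_s := (widen_ord lecd x.1, x.2).
have injf : injective f.
  by move=> [x1 x2] [y1 y2] [/= e1 ->]; congr pair; apply: val_inj.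
have KfE x y : Kmult d s (f x) (f y) = Kmult c s x y by [].
have [|[g [injg gH]]|[g [injg gH]]] := arr (fun x y => H (f x) (f y)).
- by split=> [x y|x y /subH]; [exact: symH | rewrite KfE].
- by left; exists (f \o g); split=> [|x y /gH //]; apply: inj_comp.
- right; exists (f \o g); split=> [|x y /gH]; first exact: inj_comp.
  by rewrite /rel_compl KfE.
Qed.

Lemma contains_star (V : finType) (E : rel V) (n : nat) (v : V) :
  irreflexive E -> n <= #|[set w | E v w]| -> symmetric E ->
  contains_copy (star n) E.
Proof.
move=> irrE len symE.
pose N := [set w | E v w].
pose g (i : 'I_n) : V := enum_val (widen_ord len i).
have gN i : E v (g i) by have := enum_valP (widen_ord len i); rewrite inE.
have injg : injective g.
  by move=> i j /enum_val_inj /(congr1 val) /= eij; apply: val_inj.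
have gv i : g i != v by apply/eqP=> e; have := gN i; rewrite e irrE.
exists (fun i => if unlift ord0 i is Some j then g j else v); split.
- move=> i j; case: unliftP => [i' ->|->]; case: unliftP => [j' ->|->] //.
  + by move=> /injg ->.
  + by move/eqP; rewrite (negPf (gv _)).
  + by move/esym/eqP; rewrite (negPf (gv _)).
- move=> i j; rewrite /star.
  case: unliftP => [i' ->|->]; case: unliftP => [j' ->|->];
    rewrite ?eqxx ?[lift _ _ == _]eq_sym ?(negPf (neq_lift _ _)) //= => _.
  by rewrite symE.
Qed.

Lemma star_bound (V : finType) (E : rel V) (n : nat) :
  contains_copy (star n) E -> exists v, n <= #|[set w | E v w]|.
Proof.
move=> [f [injf fE]]; exists (f ord0).
have cardf : n = #|[set f (lift ord0 i) | i : 'I_n]|.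
  by rewrite card_imset ?card_ord // => i j /injf /lift_inj.
apply: leq_trans (eq_leq cardf) _.
apply: subset_leq_card; apply/subsetP=> w /imsetP [i _ ->].
by rewrite inE; apply: fE; rewrite /star eqxx eq_sym (negPf (neq_lift _ _)).
Qed.

Lemma C4_of_cherries (V : finType) (E : rel V) (v w x w' : V) :
  symmetric E -> irreflexive E -> v != x -> w != w' ->
  E v w -> E v w' -> E x w -> E x w' -> contains_copy C4 E.
Proof.
move=> symE irrE vx ww' vw vw' xw xw'.
have neq a b : E a b -> a != b by apply: contraTneq => ->; rewrite irrE.
exists (fun i : 'I_4 => nth v [:: v; w; x; w'] i); split.
- have un : uniq [:: v; w; x; w'].
    rewrite /= !inE !negb_or vx ww' !neq //=; by rewrite symE.
  by move=> i j /eqP; rewrite nth_uniq // => /eqP /val_inj.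
- move=> [[|[|[|[|//]]]] hi] [[|[|[|[|//]]]] hj] //= _;
    by rewrite // symE.
Qed.

Lemma cherries_of_C4 (V : finType) (E : rel V) :
  symmetric E -> contains_copy C4 E ->
  exists v w x w', [/\ v != x, w != w', E v w & E v w'] /\ E x w /\ E x w'.
Proof.
move=> symE [f [injf fE]].
pose o (i : nat) (h : i < 4) : 'I_4 := Ordinal h.
exists (f (@o 0 isT)), (f (@o 1 isT)), (f (@o 2 isT)), (f (@o 3 isT)).
by rewrite !(inj_eq injf); do !split=> //; rewrite ?fE // symE fE.
Qed.

(* The 2-paths starting at a fixed vertex have distinct endpoints in a
   [C4]-free graph. *)
Lemma C4_of_min_degree (V : finType) (E : rel V) (d : nat) (v : V) :
  symmetric E -> irreflexive E -> (forall x, d <= #|[set y | E x y]|) ->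
  #|V| <= d * d.-1 -> contains_copy C4 E.
Proof.
move=> symE irrE degE cardV.
pose common x := [set w | E v w & E w x].
have [/existsP [x /andP [xv /card_gt1P [w [w' []]]]]|] :=
    boolP [exists x, (x != v) && (1 < #|common x|)].
  rewrite !inE => /andP [vw wx] /andP [vw' w'x] ww'.
  by apply: (@C4_of_cherries _ _ v w x w') => //; rewrite 1?eq_sym // symE.
rewrite negb_exists => /forallP noC; exfalso.
(* Double count the 2-paths [v ~ w ~ x] with [x != v]: each [x] now has at most one middle vertex
   [w]. *)
have: \sum_(w in [set w | E v w]) #|[set y | E w y] :\ v| <= \sum_(x | x != v) 1.
  rewrite (eq_bigr (fun w => \sum_(x | x != v) (E w x : nat))); last first.
    move=> w _; rewrite -sum1_card big_mkcond [RHS]big_mkcond /=.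
    by apply: eq_bigr => x _; rewrite !inE; case: eqP => //= _; case: (E w x).
  rewrite exchange_big /=; apply: leq_sum => x xv.
  have := noC x; rewrite xv /= -leqNgt; apply: leq_trans.
  rewrite -sum1_card big_mkcond [X in _ <= X]big_mkcond /=.
  by apply: leq_sum => w _; rewrite !inE; case: (E v w); case: (E w x).
rewrite sum1_card.
have -> : #|[pred x | x != v]| = #|V|.-1.
  by rewrite -(cardC1 v); apply: eq_card => x; rewrite !inE.
have lower : d * d.-1 <= \sum_(w in [set w | E v w]) #|[set y | E w y] :\ v|.
  apply: (@leq_trans (\sum_(w in [set w | E v w]) d.-1)).
    by rewrite sum_nat_const leq_mul.
  apply: leq_sum => w; rewrite inE => vw.
  have := degE w; rewrite (cardsD1 v) inE symE vw add1n; lia.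
have V0 : 0 < #|V| by apply/card_gt0P; exists v.
lia.
Qed.

Lemma Kmult_nbrs (c : nat) (H : rel ('I_c * 'I_2)) (x : 'I_c * 'I_2) :
  subrel H (Kmult c 2) ->
  #|[set y | H x y]| + #|[set y | rel_compl H x y]| = (2 * c).-2.
Proof.
move=> subH.
have -> : #|[set y | H x y]| = #|[set y | Kmult c 2 x y] :&: [set y | H x y]|.
  apply: eq_card => y; rewrite !inE.
  by case: (boolP (H x y)) => [/subH ->|]; rewrite ?andbF.
have -> : #|[set y | rel_compl H x y]| =
          #|[set y | Kmult c 2 x y] :\: [set y | H x y]|.
  by apply: eq_card => y; rewrite !inE andbC.
rewrite cardsID.
have := cardsC [set y | Kmult c 2 x y]; rewrite card_prod !card_ord.
have -> : #|~: [set y | Kmult c 2 x y]| = 2; last by lia.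
rewrite -[RHS](card_ord 2) -(card_imset _ (f := fun j : 'I_2 => (x.1, j))).
  apply: eq_card => -[y1 y2]; rewrite !inE negbK.
  apply/eqP/imsetP => [/= ->|[j _ [-> _]] //].
  by exists y2.
by move=> i j [].
Qed.

(** Without a star, each vertex has at most [n - 1] of its [2c - 2] possible neighbours in the
    complement, so [H] has minimum degree at least [2c - 1 - n]. *)
Lemma arrows_of_count (n c : nat) :
  0 < c -> 0 < n -> 2 * c <= (2 * c - 1 - n) * (2 * c - 1 - n).-1 ->
  arrows 2 n c.
Proof.
move=> c0 n0 count H [symH subH].
have irrH : irreflexive H.
  by move=> x; apply/negP => /subH; rewrite /Kmult eqxx.
have symC : symmetric (rel_compl H).
  by move=> x y; rewrite /rel_compl symH /Kmult eq_sym.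
have irrC : irreflexive (rel_compl H) by move=> x; rewrite /rel_compl /Kmult eqxx.
have [/existsP [x xn]|] := boolP [exists x, n <= #|[set y | rel_compl H x y]|].
  by right; apply: (contains_star irrC xn).
rewrite negb_exists => /forallP small; left.
apply: (@C4_of_min_degree _ _ (2 * c - 1 - n) (Ordinal c0, ord0)) => //.
- by move=> x; have := small x; have := Kmult_nbrs x subH; lia.
- by rewrite card_prod !card_ord mulnC.
Qed.

(** * Perfect matchings in the complement *)

Definition partner (c : nat) (x : 'I_c * 'I_2) : 'I_c * 'I_2 :=
  (x.1, rev_ord x.2).

Lemma partnerK (c : nat) : involutive (@partner c).
Proof. by move=> [x1 x2]; rewrite /partner /= rev_ordK. Qed.

Lemma partner_neq (c : nat) (x : 'I_c * 'I_2) : partner x != x.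
Proof. by case: x => [x1 [[|[|//]] h]]; rewrite /partner xpair_eqE eqxx. Qed.

Lemma same_class (c : nat) (x y : 'I_c * 'I_2) :
  x.1 = y.1 -> y = x \/ y = partner x.
Proof.
case: x y => [x1 [[|[|//]] hx]] [y1 [[|[|//]] hy]] /= <-; [left|right|right|left];
  by congr pair; apply: val_inj.
Qed.

(* A pair [u, v] of adjacent partners is repaired by exchanging [v] with a
   vertex [w] such that neither [u, w] nor [v, partner w] are adjacent; as [v]
   violates both conditions, fewer than [2 D] vertices violate one of them. *)
Lemma perfect_matching (c D : nat) (h : rel ('I_c * 'I_2)) :
  symmetric h -> (forall x, #|[set y | h x y]| <= D) -> D < c ->
  exists2 g : 'I_c * 'I_2 -> 'I_c * 'I_2,
    injective g & forall x, ~~ h (g x) (g (partner x)).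
Proof.
move=> symh degh ltDc.
(* Induction on the number [k] of classes already occupied by non-adjacent pairs. *)
suff /(_ c (leqnn c)) [g injg gP] : forall k, k <= c ->
    exists2 g : 'I_c * 'I_2 -> 'I_c * 'I_2,
      injective g & forall x : 'I_c * 'I_2, x.1 < k -> ~~ h (g x) (g (partner x)).
  by exists g => // x; apply: gP.
elim=> [_|k IHk ltkc]; first by exists id.
have [g injg gP] := IHk (ltnW ltkc).
pose u : 'I_c * 'I_2 := (Ordinal ltkc, ord0).
pose v := partner u.
have class_k (x : 'I_c * 'I_2) : x.1 < k.+1 -> [\/ x.1 < k, x = u | x = v].
  rewrite ltnS leq_eqVlt => /orP [/eqP xk|]; last by constructor 1.
  by have [|->|->] := @same_class _ u x; [exact: val_inj|constructor 2|constructor 3].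
have [huv|nuv] := boolP (h (g u) (g v)); last first.
  exists g => // x /class_k [/gP //|->|->] //.
  by rewrite /v partnerK symh.
pose B1 := [set w | h (g u) (g w)].
pose B2 := [set w | h (g v) (g (partner w))].
have B1D : #|B1| <= D.
  rewrite -(card_imset _ injg); apply: leq_trans (degh (g u)).
  by apply: subset_leq_card; apply/subsetP=> _ /imsetP [w + ->]; rewrite !inE.
have B2D : #|B2| <= D.
  have inj2 : injective (g \o @partner c).
    by apply: inj_comp => //; apply: inv_inj (@partnerK c).
  rewrite -(card_imset _ inj2); apply: leq_trans (degh (g v)).
  by apply: subset_leq_card; apply/subsetP=> _ /imsetP [w + ->]; rewrite !inE.
have vB : v \in B1 :&: B2 by rewrite !inE huv /v partnerK symh huv.
have [w] : exists w, w \notin u |: (B1 :|: B2).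
  apply/existsP; rewrite -negb_forall; apply/negP => /forallP full.
  have : #|{: 'I_c * 'I_2}| <= #|u |: (B1 :|: B2)|.
    by apply: subset_leq_card; apply/subsetP => x _; apply: full.
  rewrite card_prod !card_ord cardsU1.
  have := cardsUI B1 B2.
  have : 0 < #|B1 :&: B2| by apply/card_gt0P; exists v.
  have := leq_b1 (u \notin B1 :|: B2). lia.
rewrite !inE !negb_or => /and3P [wu nuw nvw].
have wv : w != v.
  by apply: contraNneq nuw => ->.
have pw_v : partner w != v by rewrite (inj_eq (inv_inj (@partnerK c))).
have uv : u != v by rewrite eq_sym partner_neq.
(* The exchange changes only two pairs, which become [u, w] and [v, partner w]. *)
exists (g \o tperm v w); first exact/inj_comp/perm_inj.
have gu : tperm v w u = u by rewrite tpermD // eq_sym.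
have gpw : tperm v w (partner w) = partner w.
  by rewrite tpermD // eq_sym // partner_neq.
move=> x xk /=.
have [->|xv] := eqVneq x v.
  by rewrite tpermL /v partnerK gu symh.
have [->|xw] := eqVneq x w; first by rewrite tpermR gpw.
have [->|xu] := eqVneq x u; first by rewrite gu tpermL.
have [->|xpw] := eqVneq x (partner w); first by rewrite gpw partnerK tpermR symh.
have pxv : partner x != v by rewrite (inj_eq (inv_inj (@partnerK c))).
have pxw : partner x != w by rewrite -(partnerK w) (inj_eq (inv_inj (@partnerK c))).
rewrite !tpermD; do ?by rewrite eq_sym.
have [/gP //|xu'|xv'] := class_k _ xk; first by rewrite xu' eqxx in xu.
by rewrite xv' eqxx in xv.
Qed.

(** Place [W] on [K_{c x 2}] with the matched non-adjacent pairs as classes. No edge of the graph is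
    lost, so complement degrees are at most [2c - 2 - d < n]. *)
Lemma not_arrows_of_graph (V : finType) (E : rel V) (W : {set V})
    (n c d D : nat) :
  symmetric E -> irreflexive E ->
  (forall u v w w', u != v -> w != w' ->
     E u w -> E u w' -> E v w -> E v w' -> False) ->
  #|W| = 2 * c -> D < c -> 2 * c - 1 <= n + d ->
  (forall v, v \in W -> d <= #|[set w in W | E v w]| <= D) ->
  ~ arrows 2 n c.
Proof.
move=> symE irrE noC4 cardW ltDc led degE arr.
have cardV : #|{: 'I_c * 'I_2}| = #|W| by rewrite card_prod !card_ord cardW mulnC.
pose f (x : 'I_c * 'I_2) : V := enum_val (cast_ord cardV (enum_rank x)).
have injf : injective f.
  by move=> x y /enum_val_inj /cast_ord_inj /enum_rank_inj.
have fW x : f x \in W by exact: enum_valP.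
(* An injection into [W] is onto by cardinality, so it preserves degrees; this serves both before
   and after the matching. *)
have cardN (f' : 'I_c * 'I_2 -> V) x : injective f' -> (forall x, f' x \in W) ->
    #|[set y | E (f' x) (f' y)]| = #|[set w in W | E (f' x) w]|.
  move=> injf' f'W; rewrite -(card_imset _ injf'); apply: eq_card => w.
  have imW : f' @: setT = W.
    apply/eqP; rewrite eqEcard card_imset // cardsT cardV leqnn andbT.
    by apply/subsetP => _ /imsetP [y _ ->].
  rewrite inE -imW; apply/imsetP/andP => [[y]|[/imsetP [y _ ->] yE]].
    by rewrite inE => yE ->; rewrite imset_f.
  by exists y; rewrite ?inE.
have [||g injg gP] := @perfect_matching c D (fun x y => E (f x) (f y)) _ _ ltDc.
- by move=> x y; exact: symE.
- by move=> x; rewrite cardN //; case/andP: (degE _ (fW x)).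
pose F := f \o g; have injF : injective F := inj_comp injf injg.
pose H x y := E (F x) (F y).
have subH : subgraph_Kmult H.
  split=> [x y|x y Hxy]; first exact: symE.
  apply/eqP => /same_class [eyx|eyx]; move: Hxy; rewrite eyx /H ?irrE //.
  by apply/negP; exact: gP.
have [/cherries_of_C4|/star_bound] := arr H subH.
- case=> [x y|u [w [v [w' [[uv ww' uw uw'] [vw vw']]]]]]; first exact: symE.
  by apply: (noC4 (F u) (F v) (F w) (F w')); rewrite ?(inj_eq injF).
- case=> x; have := Kmult_nbrs x (proj2 subH).
  rewrite /H cardN //; last by move=> y; exact: fW.
  have /andP [+ _] := degE (F x) (fW _).
  have := ltn_ord x.1; lia.
Qed.

(** * Polarity graphs *)

Import GRing.Theory.
Local Open Scope ring_scope.

Section Plane.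
Variable F : fieldType.

(* The projective plane over [F] through the normalised coordinates
   [(x, y, 1)], [(x, 1, 0)] and [(1, 0, 0)]. *)
Definition point : Type := (F * F + (F + unit))%type.

Definition px (P : point) : F :=
  match P with inl (x, _) => x | inr (inl x) => x | inr (inr _) => 1 end.
Definition py (P : point) : F :=
  match P with inl (_, y) => y | inr (inl _) => 1 | inr (inr _) => 0 end.
Definition pz (P : point) : F :=
  match P with inl _ => 1 | inr _ => 0 end.

(** Vanishing 2 x 2 minors mean proportional coordinates, and normalised coordinates are
    proportional only if equal. *)
Lemma point_inj (P Q : point) :
  px P * py Q = px Q * py P -> px P * pz Q = px Q * pz P ->
  py P * pz Q = py Q * pz P -> P = Q.
Proof.
case: P => [[x y]|[x|[]]]; case: Q => [[x' y']|[x'|[]]] //=;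
  rewrite ?(mulr1, mulr0, mul1r, mul0r) => h1 h2 h3;
  do ?[by rewrite ?h1 ?h2 ?h3
     | by move/eqP: h1; rewrite ?(oner_eq0, eq_sym _ 1)
     | by move/eqP: h2; rewrite ?oner_eq0 // eq_sym oner_eq0
     | by move/eqP: h3; rewrite ?oner_eq0 // eq_sym oner_eq0].
Qed.

(** The vectors orthogonal to two independent vectors of [F^3] form a line; parallelism is expressed
    by 2 x 2 minors. *)
Lemma orthogonal_parallel (a b c a' b' c' x y z x' y' z' : F) :
  a * x + b * y + c * z = 0 -> a * x' + b * y' + c * z' = 0 ->
  a' * x + b' * y + c' * z = 0 -> a' * x' + b' * y' + c' * z' = 0 ->
  ~ [/\ x * y' = x' * y, x * z' = x' * z & y * z' = y' * z] ->
  [/\ a * b' = a' * b, a * c' = a' * c & b * c' = b' * c].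
Proof.
move=> h1 h2 h3 h4 ind.
(* Both [(a, b, c)] and [(a', b', c')] are parallel to the cross product
   [(k, l, m)] of [(x, y, z)] and [(x', y', z')]. *)
pose k := y * z' - y' * z; pose l := x' * z - x * z'; pose m := x * y' - x' * y.
have par r s t : r * x + s * y + t * z = 0 -> r * x' + s * y' + t * z' = 0 ->
    [/\ r * l = s * k, r * m = t * k & s * m = t * l].
  move=> e e'; split; apply/eqP; rewrite -subr_eq0; apply/eqP.
  - have -> : r * l - s * k =
      z * (r * x' + s * y' + t * z') - z' * (r * x + s * y + t * z).
      by rewrite /k /l; ring.
    by rewrite e e' !mulr0 subr0.
  - have -> : r * m - t * k =
      y' * (r * x + s * y + t * z) - y * (r * x' + s * y' + t * z').
      by rewrite /k /m; ring.
    by rewrite e e' !mulr0 subr0.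
  - have -> : s * m - t * l =
      x * (r * x' + s * y' + t * z') - x' * (r * x + s * y + t * z).
      by rewrite /l /m; ring.
    by rewrite e e' !mulr0 subr0.
have [p1 p2 p3] := par _ _ _ h1 h2; have [p4 p5 p6] := par _ _ _ h3 h4.
have [k0|k0] := eqVneq k 0; last first.
  split; apply: (mulIf k0); apply: (mulIf k0).
  - by rewrite -[RHS]mulrA [RHS]mulrACA -p1 -mulrA mulrACA -p4; ring.
  - by rewrite -[RHS]mulrA [RHS]mulrACA -p2 -mulrA mulrACA -p5; ring.
  - rewrite -[LHS]mulrA mulrACA -p1 -p5 -[RHS]mulrA [RHS]mulrACA -p2 -p4; ring.
have [l0|l0] := eqVneq l 0; last first.
  split; apply: (mulIf l0); apply: (mulIf l0).
  - by rewrite -[LHS]mulrA mulrACA p1 -[RHS]mulrA [RHS]mulrACA p4; ring.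
  - by rewrite -[LHS]mulrA mulrACA p1 -p6 -[RHS]mulrA [RHS]mulrACA p4 -p3; ring.
  - by rewrite -[LHS]mulrA mulrACA -p6 -[RHS]mulrA [RHS]mulrACA -p3; ring.
have [m0|m0] := eqVneq m 0; last first.
  split; apply: (mulIf m0); apply: (mulIf m0).
  - by rewrite -[LHS]mulrA mulrACA p2 p6 -[RHS]mulrA [RHS]mulrACA p3 p5; ring.
  - by rewrite -[LHS]mulrA mulrACA p2 -[RHS]mulrA [RHS]mulrACA p5; ring.
  - by rewrite -[LHS]mulrA mulrACA p3 -[RHS]mulrA [RHS]mulrACA p6; ring.
case: ind; split; apply/eqP; rewrite -subr_eq0; apply/eqP => //.
by rewrite -[LHS]opprK opprB -/l l0 oppr0.
Qed.

Lemma point_nz (P : point) : (px P != 0) || (py P != 0) || (pz P != 0).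
Proof. by case: P => [[x y]|[x|[]]] /=; rewrite oner_eq0 ?orbT. Qed.

Variable e : F.
Hypotheses (e0 : e != 0) (e4 : e * 2 = 4).

Definition form (P Q : point) : F :=
  e * px P * px Q - pz P * py Q - py P * pz Q.

Lemma formC P Q : form P Q = form Q P.
Proof. by rewrite /form; ring. Qed.

Definition conic (t : F) : point := inl (t, t ^+ 2).

Lemma conic_inj : injective conic. Proof. by move=> s t []. Qed.

Lemma form_conic P t : form P (conic t) = e * px P * t - pz P * t ^+ 2 - py P.
Proof. by rewrite /form /= mulr1. Qed.

(** The polar of [P] has coefficients [(e x, -z, -y)], so distinct points have distinct polars,
    which share a single point. This excludes [C_4]. *)
Lemma form_common P Q R S : P != Q -> R != S ->
  form P R = 0 -> form P S = 0 -> form Q R = 0 -> form Q S = 0 -> False.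
Proof.
move=> nPQ nRS h1 h2 h3 h4.
have formE A B : form A B = (e * px A) * px B + (- pz A) * py B + (- py A) * pz B.
  by rewrite /form; ring.
rewrite !formE in h1 h2 h3 h4.
have [|h5 h6 h7] := orthogonal_parallel h1 h2 h3 h4.
  by move=> [/point_inj h5 h6 h7]; rewrite h5 ?eqxx in nRS.
move: h5 h6 h7; rewrite !mulrN !mulNr !opprK -!mulrA => /oppr_inj /(mulfI e0) h5.
move=> /oppr_inj /(mulfI e0) h6 h7.
by rewrite (@point_inj P Q) ?eqxx // in nPQ; rewrite mulrC -h7 mulrC.
Qed.

(** Vieta's formulas for the polynomial [z t^2 - e x t + y], whose roots are the conic points on the
    polar of [P]. *)
Lemma form_conic2 P s t : s != t ->
  form P (conic s) = 0 -> form P (conic t) = 0 ->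
  e * px P = pz P * (s + t) /\ py P = pz P * s * t.
Proof.
move=> st; rewrite !form_conic => hs ht.
have h : e * px P = pz P * (s + t).
  have st0 : s - t != 0 by rewrite subr_eq0.
  apply: (mulIf st0); apply/eqP; rewrite -subr_eq0; apply/eqP.
  rewrite -[RHS](subr0 0) -{1}hs -ht; ring.
split=> //; apply/eqP; rewrite eq_sym -subr_eq0 -hs h; apply/eqP; ring.
Qed.

(** Comparing the root sums of two pairs gives [z (r - s) = 0]; then all coordinates of [P]
    vanish. *)
Lemma form_conic3 P s t r : s != t -> t != r -> r != s ->
  form P (conic s) = 0 -> form P (conic t) = 0 -> form P (conic r) = 0 -> False.
Proof.
move=> st tr rs hs ht hr.
have [h1 h2] := form_conic2 st hs ht.
have [h3 h4] := form_conic2 tr ht hr.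
have z0 : pz P = 0.
  have rs0 : r - s != 0 by rewrite subr_eq0.
  apply: (mulIf rs0); rewrite mul0r; apply/eqP.
  have -> : pz P * (r - s) = pz P * (t + r) - pz P * (s + t) by ring.
  by rewrite -h1 -h3 subrr.
have := point_nz P; rewrite h2 z0 !mul0r !eqxx !orbF.
by move/eqP: h1; rewrite z0 mul0r mulf_eq0 (negPf e0) /= => /eqP ->; rewrite eqxx.
Qed.

(* The polar of an absolute point is tangent: its discriminant
   [(e x)^2 - 4 y z] vanishes because [2 e = 4]. *)
Lemma form_absolute_conic2 P s t : s != t -> form P P = 0 ->
  form P (conic s) = 0 -> form P (conic t) = 0 -> False.
Proof.
move=> st hP hs ht; have [h1 h2] := form_conic2 st hs ht.
have st0 : s - t != 0 by rewrite subr_eq0.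
have z0 : pz P = 0.
  have /eqP : (pz P * (s - t)) ^+ 2 = 0.
    have -> : (pz P * (s - t)) ^+ 2
        = (pz P * (s + t)) ^+ 2 - 4 * pz P * (pz P * s * t) by ring.
    rewrite -h1 -h2 -e4.
    have -> : (e * px P) ^+ 2 - e * 2 * pz P * py P = e * form P P.
      by rewrite /form; ring.
    by rewrite hP mulr0.
  by rewrite expf_eq0 /= mulf_eq0 (negPf st0) orbF => /eqP.
have := point_nz P; rewrite h2 z0 !mul0r !eqxx !orbF.
by move/eqP: h1; rewrite z0 mul0r mulf_eq0 (negPf e0) /= => /eqP ->; rewrite eqxx.
Qed.

End Plane.

HB.instance Definition _ (F : finFieldType) :=
  Finite.copy (point F) (F * F + (F + unit))%type.

(** * Degrees in the polarity graph after deleting conic points *)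

Section Polarity.
Variables (F : finFieldType) (e : F).
Hypotheses (e0 : e != 0) (e4 : e * 2 = 4).

Lemma card_point : #|{: point F}| = (#|F| ^ 2 + #|F| + 1)%N.
Proof. by rewrite card_sum card_prod card_sum card_unit -mulnn addnA. Qed.

(** The line is parametrised by [option F], in three cases according to the first nonzero
    coefficient. *)
Lemma card_line (a b c : F) : (a != 0) || (b != 0) || (c != 0) ->
  #|[set P : point F | a * px P + b * py P + c * pz P == 0]| = #|F|.+1.
Proof.
rewrite -card_option => nz.
have [a0|a0] := eqVneq a 0; last first.
  pose f (o : option F) : point F :=
    if o is Some y then inl (- (b * y + c) / a, y) else inr (inl (- b / a)).
  rewrite -(card_imset _ (f := f)); last first.
    by move=> [y|] [y'|] //= [_ ->].
  apply: eq_card => P; rewrite !inE; apply/eqP/imsetP => [|[[y|] _ ->] /=].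
  - case: P => [[x y]|[x|[]]] /= h.
    + exists (Some y) => //=; congr (inl (_, _)); apply: (mulIf a0).
      by rewrite divfK //; apply/eqP; rewrite -subr_eq0 -h; apply/eqP; ring.
    + exists None => //=; congr (inr (inl _)); apply: (mulIf a0).
      by rewrite divfK //; apply/eqP; rewrite -subr_eq0 -h; apply/eqP; ring.
    + by case/eqP: a0; rewrite -h; ring.
  - by rewrite mulrC divfK //; ring.
  - by rewrite mulrC divfK //; ring.
rewrite a0 eqxx /= in nz *.
have [b0|b0] := eqVneq b 0; last first.
  pose f (o : option F) : point F :=
    if o is Some x then inl (x, - c / b) else inr (inr tt).
  rewrite -(card_imset _ (f := f)); last first.
    by move=> [y|] [y'|] //= [->].
  apply: eq_card => P; rewrite !inE; apply/eqP/imsetP => [|[[y|] _ ->] /=].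
  - case: P => [[x y]|[x|[]]] /= h.
    + exists (Some x) => //=; congr (inl (_, _)); apply: (mulIf b0).
      by rewrite divfK //; apply/eqP; rewrite -subr_eq0 -h; apply/eqP; ring.
    + by case/eqP: b0; rewrite -h; ring.
    + by exists None.
  - by rewrite [b * _]mulrC divfK //; ring.
  - by ring.
rewrite b0 eqxx /= in nz *.
pose f (o : option F) : point F :=
  if o is Some x then inr (inl x) else inr (inr tt).
rewrite -(card_imset _ (f := f)); last first.
  by move=> [y|] [y'|] //= [->].
apply: eq_card => P; rewrite !inE; apply/eqP/imsetP => [|[[y|] _ ->] /=].
- case: P => [[x y]|[x|[]]] /= h.
  + by case/eqP: nz; rewrite -h; ring.
  + by exists (Some x).
  + by exists None.
- by ring.
- by ring.
Qed.

Lemma card_polar (P : point F) : #|[set Q | form e P Q == 0]| = #|F|.+1.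
Proof.
rewrite -(@card_line (e * px P) (- pz P) (- py P)).
  by apply: eq_card => Q; rewrite !inE /form; congr (_ == _); ring.
by rewrite mulf_eq0 (negPf e0) !oppr_eq0 /= orbAC point_nz.
Qed.

(** Of the [q + 1] points of the polar, at most two are lost: two conic points, or, if [P] is
    absolute, [P] itself and one conic point. *)
Lemma polarity_graph_degree (A : {set F}) (P : point F) :
  P \notin @conic F @: A ->
  (#|F|.-1 <= #|[set Q in ~: (@conic F @: A) | (form e P Q == 0)%R && (P != Q)]|
    <= #|F|.+1)%N.
Proof.
move=> nP; set L := [set Q | form e P Q == 0]; set S := @conic F @: A.
have setE : [set Q in ~: S | (form e P Q == 0) && (P != Q)] = L :\: (P |: S).
  apply/setP=> Q; rewrite !inE negb_or (eq_sym Q).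
  by case: (form e P Q == 0); case: (P != Q); case: (Q \in S).
rewrite setE -(card_polar P) -/L subset_leq_card ?subsetDl // andbT.
suff : (#|L :&: (P |: S)| <= 2)%N.
  by have := cardsID (P |: S) L; rewrite {1 2}/L card_polar -/L; lia.
have SP Q : Q \in L :&: S -> exists2 t, Q = conic t & form e P (conic t) = 0.
  by rewrite !inE => /andP [/eqP fQ /imsetP [t _ QE]]; exists t; rewrite -?QE.
have [fPP|fPP] := eqVneq (form e P P) 0.
  have -> : L :&: (P |: S) = P |: (L :&: S).
    by apply/setP=> Q; rewrite !inE; case: (eqVneq Q P) => // ->; rewrite fPP eqxx.
  rewrite cardsU1; suff: (#|L :&: S| <= 1)%N by case: (_ \notin _); lia.
  rewrite leqNgt; apply/card_gt1P => -[Q [R [/SP [s -> hs] /SP [t -> ht] QR]]].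
  by apply: (form_absolute_conic2 e0 e4 _ fPP hs ht); apply: contraNneq QR => ->.
have -> : L :&: (P |: S) = L :&: S.
  by apply/setP=> Q; rewrite !inE; case: (eqVneq Q P) => // ->; rewrite (negPf fPP).
rewrite leqNgt; apply/card_gt2P.
move=> -[Q [R [T [[/SP [s -> hs] /SP [t -> ht] /SP [r -> hr]] [QR RT TQ]]]]].
apply: (form_conic3 e0 _ _ _ hs ht hr);
  [apply: contraNneq QR|apply: contraNneq RT|apply: contraNneq TQ]; by move=> ->.
Qed.

End Polarity.

Lemma not_arrows_polarity (F : finFieldType) (m n c : nat) :
  (3 <= #|F|)%N -> (m <= #|F|)%N -> (2 * c + m = #|F| ^ 2 + #|F| + 1)%N ->
  (2 * c <= n + #|F|)%N -> ~ arrows 2 n c.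
Proof.
move=> q3 mq cE nE.
have [e [e0 e4]] : exists e : F, e != 0 /\ e * 2 = 4.
  (* In characteristic 2 both sides of [e * 2 = 4] vanish, so [1] serves; otherwise [2] does. *)
  have [h2|h2] := eqVneq (2 : F) 0.
    exists 1; rewrite oner_eq0; split=> //.
    have -> : (4 : F) = 2 * 2 by ring.
    by rewrite h2 !mulr0.
  by exists 2; split=> //; ring.
have [A cardA] : exists A : {set F}, #|A| = m.
  exists [set x in take m (enum F)]; rewrite cardsE (card_uniqP _).
    by rewrite size_takel // -cardE.
  by rewrite take_uniq ?enum_uniq.
apply: (@not_arrows_of_graph _ (fun P Q => (form e P Q == 0) && (P != Q))
          (~: (@conic F @: A)) _ _ #|F|.-1 #|F|.+1).
- by move=> P Q; rewrite formC (eq_sym P).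
- by move=> P; rewrite eqxx andbF.
- move=> P Q R S PQ RS /andP [/eqP h1 _] /andP [/eqP h2 _] /andP [/eqP h3 _].
  by move=> /andP [/eqP h4 _]; apply: (form_common e0 PQ RS h1 h2 h3 h4).
- have := cardsC (@conic F @: A).
  by rewrite (card_imset _ (@conic_inj F)) cardA card_point; lia.
- nia.
- lia.
- by move=> P; rewrite inE; apply: polarity_graph_degree.
Qed.

(** * The determinant graph in characteristic 2 *)

Section Determinant.
Variable F : fieldType.

Definition det2 (u v : F * F) : F := u.1 * v.2 - u.2 * v.1.

Lemma det2_eq0 (u v : F * F) :
  u != 0 -> det2 u v = 0 -> exists l, v = (l * u.1, l * u.2).
Proof.
case: u v => [u1 u2] [v1 v2]; rewrite /det2 /= => u0 /eqP; rewrite subr_eq0 => /eqP h.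
have [u10|u10] := eqVneq u1 0; last first.
  exists (v1 / u1); rewrite divfK //; congr pair; apply: (mulfI u10).
  by rewrite h; field.
have u20 : u2 != 0.
  by apply: contraNneq u0 => u20; rewrite u10 u20.
exists (v2 / u2); rewrite divfK //; congr pair; apply: (mulfI u20).
by rewrite -h; field.
Qed.

Lemma det2B (u v w : F * F) : det2 u (v - w) = det2 u v - det2 u w.
Proof. by rewrite /det2 /=; ring. Qed.

Hypothesis char2 : 2 = 0 :> F.

Lemma opp_char2 (x : F) : - x = x.
Proof.
apply/eqP; rewrite -subr_eq0; have -> : - x - x = - (2 * x) by ring.
by rewrite char2 mul0r oppr0.
Qed.

Lemma det2C (u v : F * F) : det2 u v = det2 v u.
Proof. by rewrite -[RHS]opp_char2 /det2; ring. Qed.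

(** A common neighbour of [w] and [w'] is a multiple of [w - w'], and [det2 u w = 1] determines the
    multiple. *)
Lemma det2_common (u v w w' : F * F) : u != v -> w != w' ->
  det2 u w = 1 -> det2 u w' = 1 -> det2 v w = 1 -> det2 v w' = 1 -> False.
Proof.
move=> uv ww' h1 h2 h3 h4.
have d0 : w - w' != 0 by rewrite subr_eq0.
have [l uE] : exists l, u = (l * (w - w').1, l * (w - w').2).
  by apply: det2_eq0; rewrite // det2C det2B h1 h2 subrr.
have [m vE] : exists m, v = (m * (w - w').1, m * (w - w').2).
  by apply: det2_eq0; rewrite // det2C det2B h3 h4 subrr.
have lin r : det2 (r * (w - w').1, r * (w - w').2) w = r * det2 (w - w') w.
  by rewrite /det2 /=; ring.
move: h1 h3; rewrite uE vE !lin => h1 h3.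
have dw0 : det2 (w - w') w != 0.
  by apply: contra_eq_neq h1 => ->; rewrite mulr0 eq_sym oner_eq0.
have lm : l = m by apply: (mulIf dw0); rewrite h1 h3.
by rewrite uE vE lm eqxx in uv.
Qed.

Variable a : F.

(** In characteristic 2, the norm form of the quadratic extension by a root of [t^2 + t + a], when
    this has no root in [F]. *)
Definition qform (u : F * F) : F := u.1 ^+ 2 + u.1 * u.2 + a * u.2 ^+ 2.

(* In characteristic 2 the polar form of [qform] is [det2], so along the line
   [det2 u v = 1] in direction [u] two points of norm 1 differ by
   [u / qform u]. *)
Lemma qform_line (u p r : F * F) : u != 0 -> p != r ->
  det2 u p = 1 -> det2 u r = 1 -> qform p = 1 -> qform r = 1 ->
  exists2 l, r = (p.1 + l * u.1, p.2 + l * u.2) & l * qform u = 1.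
Proof.
move=> u0 pr hp hr qp qr.
have [l dE] : exists l, r - p = (l * u.1, l * u.2).
  by apply: det2_eq0; rewrite // det2B hp hr subrr.
have rE : r = (p.1 + l * u.1, p.2 + l * u.2).
  rewrite -[LHS](subrK p) dE; apply/eqP.
  by rewrite xpair_eqE /= ![_ + p.1]addrC ![_ + p.2]addrC !eqxx.
exists l => //.
have l0 : l != 0.
  apply: contraNneq pr => l0; rewrite rE l0 !mul0r !addr0; apply/eqP.
  by case: (p).
have: qform r - qform p = 0 by rewrite qp qr subrr.
have -> : qform r - qform p
    = l * (l * qform u - det2 u p + 2 * (p.1 * u.1 + a * p.2 * u.2 + p.2 * u.1)).
  by rewrite rE /qform /det2 /=; ring.
rewrite char2 mul0r addr0 hp => /eqP; rewrite mulf_eq0 (negPf l0) subr_eq0.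
by move/eqP.
Qed.

(** Both [r] and [t] would equal [p + u / qform u]. *)
Lemma qform_line3 (u p r t : F * F) : u != 0 -> p != r -> r != t -> t != p ->
  det2 u p = 1 -> det2 u r = 1 -> det2 u t = 1 ->
  qform p = 1 -> qform r = 1 -> qform t = 1 -> False.
Proof.
move=> u0 pr rt tp hp hr ht qp qr qt.
have [l rE hl] := qform_line u0 pr hp hr qp qr.
have [m tE hm] : exists2 l, t = (p.1 + l * u.1, p.2 + l * u.2) & l * qform u = 1.
  by apply: qform_line => //; rewrite eq_sym.
have q0 : qform u != 0.
  by apply: contra_eq_neq hl => ->; rewrite mulr0 eq_sym oner_eq0.
have lm : l = m by apply: (mulIf q0); rewrite hl hm.
by rewrite rE tE lm eqxx in rt.
Qed.

End Determinant.

(** * Degrees in the determinant graph after deleting a conic *)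

Lemma card_det2 (F : finFieldType) (u : F * F) :
  u != 0 -> #|[set v | det2 u v == 1]| = #|F|.
Proof.
case: u => u1 u2 u0.
have [u10|u10] := eqVneq u1 0; last first.
  rewrite -(card_imset _ (f := fun y : F => (y, (1 + u2 * y) / u1))).
    apply: eq_card => -[y z]; rewrite !inE /det2 /=.
    apply/eqP/imsetP => [h|[y' _ [-> ->]]].
      by exists y => //; congr pair; apply: (mulfI u10); rewrite -h; field.
    by field.
  by move=> y y' [].
have u20 : u2 != 0.
  by apply: contraNneq u0 => u20; rewrite u10 u20.
rewrite -(card_imset _ (f := fun z : F => (- u2^-1, z))).
  apply: eq_card => -[y z]; rewrite !inE /det2 /= u10 mul0r sub0r.
  apply/eqP/imsetP => [h|[y' _ [-> _]]].
    by exists z => //; congr pair; apply: (mulfI u20); rewrite mulrN divff // -h opprK.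
  by field.
by move=> y y' [].
Qed.

Lemma norm_one_set (F : finFieldType) : 2 = 0 :> F ->
  exists (a : F) (S : {set F * F}),
    #|S| = #|F|.+1 /\ forall u, u \in S -> u != 0 /\ qform a u = 1.
Proof.
move=> char2.
have sq_inj : injective (fun x : F => x ^+ 2).
  move=> x y /eqP; rewrite -subr_eq0.
  have -> : x ^+ 2 - y ^+ 2 = (x - y) ^+ 2 + 2 * (y * (x - y)) by ring.
  by rewrite char2 mul0r addr0 expf_eq0 subr_eq0 => /eqP.
have [a aP] : exists a : F, forall t, t ^+ 2 + t + a != 0.
  (* The map [t^2 + t] sends both [0] and [1] to [0], so on a finite field it misses some value
     [a]. *)
  have /existsP [a aP] : [exists a : F, a \notin [set t ^+ 2 + t | t in [set: F]]].
    rewrite -negb_forall; apply/negP => /forallP full.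
    have /imset_injP inj : #|[set t ^+ 2 + t | t in [set: F]]| == #|[set: F]|.
      rewrite eqn_leq leq_imset_card /=; apply: subset_leq_card.
      by apply/subsetP => x _; have := full x.
    have /eqP : (0 : F) = 1.
      by apply: inj; rewrite ?inE // expr0n expr1n addr0; exact: esym char2.
    by rewrite eq_sym oner_eq0.
  exists a => t; apply: contraNneq aP => h; apply/imsetP; exists t => //.
  by apply/eqP; rewrite -subr_eq0 opp_char2 // addrC h.
pose rt (x : F) : F := invF sq_inj x.
have rtK x : rt x ^+ 2 = x by exact: (f_invF sq_inj).
(* Squaring is bijective, so each direction [(t, 1)], of norm [t^2 + t + a], can be scaled to norm
   1; [(1, 0)] is the remaining direction. *)
pose s t := rt (t ^+ 2 + t + a)^-1.
have s0 t : s t != 0.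
  by rewrite -sqrf_eq0 rtK invr_eq0 aP.
pose f (o : option F) : F * F := if o is Some t then (t * s t, s t) else (1, 0).
have injf : injective f.
  move=> [t|] [t'|] //= [].
  - by move=> + ss; rewrite ss => /(mulIf (s0 _)) ->.
  - by move=> _ /eqP; rewrite (negPf (s0 _)).
  - by move=> _ /esym/eqP; rewrite (negPf (s0 _)).
exists a, (f @: setT); split.
  by rewrite card_imset // cardsT card_option.
move=> _ /imsetP [[t|] _ ->]; rewrite /qform /=; split.
- by rewrite xpair_eqE (negPf (s0 _)) andbF.
- have -> : (t * s t) ^+ 2 + t * s t * s t + a * s t ^+ 2
            = (t ^+ 2 + t + a) * s t ^+ 2 by ring.
  by rewrite rtK divff.
- by rewrite xpair_eqE oner_eq0.
- by ring.
Qed.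

Lemma not_arrows_char2 (F : finFieldType) (n c : nat) :
  2 = 0 :> F -> (4 <= #|F|)%N -> (2 * c + #|F| + 2 = #|F| ^ 2)%N ->
  (2 * c + 1 <= n + #|F|)%N -> ~ arrows 2 n c.
Proof.
move=> char2 q4 cE nE; have [a [S [cardS SP]]] := norm_one_set char2.
have cardS0 : #|(0 : F * F) |: S| = #|F|.+2.
  rewrite cardsU1 cardS; have -> // : 0 \notin S.
  by apply/negP => /SP []; rewrite eqxx.
have cardW : #|~: ((0 : F * F) |: S)| = (2 * c)%N.
  have cardFF : #|{: F * F}| = (#|F| ^ 2)%N by rewrite card_prod mulnn.
  have := cardsC ((0 : F * F) |: S); rewrite cardS0 cardFF; lia.
apply: (@not_arrows_of_graph {: F * F} (fun u v => det2 u v == 1)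
          (~: ((0 : F * F) |: S)) n c (#|F| - 2)%N #|F|).
- by move=> u v; rewrite det2C.
- by move=> u; rewrite /det2 mulrC subrr eq_sym oner_eq0.
- move=> u v w w' uv ww' /eqP h1 /eqP h2 /eqP h3 /eqP h4.
  exact: (det2_common char2 uv ww').
- exact: cardW.
- nia.
- lia.
- move=> u; rewrite !inE negb_or => /andP [u0 _].
  set L := [set v | det2 u v == 1].
  have -> : [set v in ~: ((0 : F * F) |: S) | det2 u v == 1] = L :\: S.
    apply/setP=> v; rewrite !inE negb_or.
    case: (eqVneq v 0) => [->|_] //=.
    by rewrite /det2 !mulr0 subrr eq_sym oner_eq0 andbF.
  rewrite -[X in (_ <= _ <= X)%N](card_det2 u0) subset_leq_card ?subsetDl // andbT.
  suff : (#|L :&: S| <= 2)%N.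
    have cardL : #|L| = #|F| by exact: card_det2.
    by rewrite leq_subLR -cardL -(cardsID S L) leq_add2r.
  rewrite leqNgt; apply/card_gt2P.
  move=> -[p [r [t [[]]]]]; rewrite !inE => /andP [/eqP hp /SP [_ qp]].
  move=> /andP [/eqP hr /SP [_ qr]] /andP [/eqP ht /SP [_ qt]] [pr rt tp].
  exact: (qform_line3 char2 u0 pr rt tp hp hr ht qp qr qt).
Qed.

Lemma finField_of_prime_power (q : nat) : prime_power q ->
  exists F : finFieldType, #|F| = q /\ (~~ odd q -> 2 = 0 :> F).
Proof.
move=> [p [m [p_pr m0 ->]]]; have [F charF cardF] := PrimePowerField p_pr m0.
exists F; split=> //; rewrite oddX negb_or -lt0n m0 => /= podd.
have p2 : p = 2%N by case: (even_prime p_pr) => // podd'; rewrite podd' in podd.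
by have := pcharf0 charF; rewrite p2.
Qed.

(** * Values of [M_2] *)

Local Close Scope ring_scope.

(** By monotonicity in the number of classes, only [c - 1] has to be refuted. *)
Lemma is_M_intro (n c : nat) :
  1 < c -> 0 < n -> 2 * c <= (2 * c - 1 - n) * (2 * c - 1 - n).-1 ->
  ~ arrows 2 n c.-1 -> is_M 2 n c.
Proof.
move=> c1 n0 count narr; split; first by lia.
  by apply: arrows_of_count => //; lia.
move=> c' _ arr; rewrite leqNgt; apply/negP => ltc; apply: narr.
by apply: arrows_leq arr; lia.
Qed.

(* [m] is the number of points deleted from the polarity graph. *)
Lemma is_M_polarity (q m : nat) : prime_power q -> odd m -> 3 <= m <= q ->
  is_M 2 (q ^ 2 + 1 - m) ((q ^ 2 + q + 3 - m) %/ 2).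
Proof.
move=> /finField_of_prime_power [F [cardF _]] oddm /andP [m3 mq].
have sq : 3 * q <= q ^ 2 by nia.
have cE : 2 * ((q ^ 2 + q + 3 - m) %/ 2) = q ^ 2 + q + 3 - m.
  (* With [q^2 + q] even and [m] odd, the division by 2 is exact. *)
  have : odd (q ^ 2 + q) = false by rewrite oddD oddX /= addbb.
  lia.
apply: is_M_intro; [lia | lia | | ].
(* The forced minimum degree is [q + 1], and [2c <= (q + 1) q] because [m >= 3]. *)
- rewrite cE; have -> : q ^ 2 + q + 3 - m - 1 - (q ^ 2 + 1 - m) = q + 1 by lia.
  nia.
- by apply: (@not_arrows_polarity F m); rewrite ?cardF; lia.
Qed.

Theorem theoremC (q : nat) (hq : prime_power q) (hq3 : 3 <= q) :
  is_M 2 (q ^ 2 - 2) ((q ^ 2 + q) %/ 2) /\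
  (~~ odd q -> 8 <= q ->
     forall k : nat, odd k -> 3 <= k -> k <= q - 3 ->
       is_M 2 (q ^ 2 - k - 1) ((q ^ 2 + q - k + 1) %/ 2)) /\
  (~~ odd q ->
     is_M 2 ((q - 1) ^ 2 - 2) (((q - 1) ^ 2 + q - 3) %/ 2 + 1)) /\
  (odd q ->
     forall k : nat, ~~ odd k -> 2 <= k -> k <= 2 * ceil_divn q 4 ->
       is_M 2 (q ^ 2 - k) ((q ^ 2 + q - k) %/ 2 + 1)).
Proof.
have sq : 3 * q <= q ^ 2 by nia.
split; [|split; [|split]].
- have := is_M_polarity (m := 3) hq isT; rewrite hq3 => /(_ isT).
  by congr is_M; lia.
- move=> _ q8 k oddk k3 kq.
  have := is_M_polarity (m := k.+2) hq; rewrite /= negbK oddk => /(_ isT).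
  have -> : 3 <= k.+2 <= q by lia.
  move/(_ isT); congr is_M; [lia | congr divn; lia].
- move=> evenq; have [F [cardF /(_ evenq) char2]] := finField_of_prime_power hq.
  have q4 : 4 <= q by have := evenq; lia.
  have cE : 2 * (((q - 1) ^ 2 + q - 3) %/ 2 + 1) = q ^ 2 - q.
    have -> : (q - 1) ^ 2 + q - 3 = q ^ 2 - q - 2 by nia.
    have : odd (q ^ 2) = false by rewrite oddX /= (negPf evenq).
    by move: evenq; lia.
  have nE : (q - 1) ^ 2 - 2 = q ^ 2 - 2 * q - 1 by nia.
  apply: is_M_intro; [lia | lia | | ].
  (* The count is tight: minimum degree [q] against [2c = q (q - 1)] vertices. With [c - 1] classes,
     [q^2 - (q + 2)] vertices remain, as in the determinant graph. *)
  + rewrite cE nE; have -> : q ^ 2 - q - 1 - (q ^ 2 - 2 * q - 1) = q by nia.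
    nia.
  + by apply: (@not_arrows_char2 F) => //; rewrite cardF ?nE; nia.
- move=> oddq k evenk k2; rewrite /ceil_divn => kq.
  have := is_M_polarity (m := k.+1) hq; rewrite /= evenk => /(_ isT).
  (* For odd [q >= 3], twice the ceiling of [q / 4] is at most [q - 1]. *)
  have -> : 3 <= k.+1 <= q by lia.
  by move/(_ isT); congr is_M; lia.
Qed.
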